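(* Let $n,k_1,k_2,t$ be positive integers with $k_1,k_2\ge t$ and $n\ge k_1+k_2+3$. Suppose that $\mathcal{F}_1\subseteq\mathcal{M}(k_1,n)$ and $\mathcal{F}_2\subseteq\mathcal{M}(k_2,n)$ are cross $t$-intersecting families such that $|\mathcal{F}_1|\cdot|\mathcal{F}_2|$ is maximum among all pairs of cross $t$-intersecting families $\mathcal{F}_1\subseteq\mathcal{M}(k_1,n)$, $\mathcal{F}_2\subseteq\mathcal{M}(k_2,n)$. Then there exists a $t$-flat of $AG(n,\mathbb{F}_q)$ contained in every member of $\mathcal{F}_1$ and of $\mathcal{F}_2$.
   Context: $q$ is a prime power and $AG(n,\mathbb{F}_q)$ is the $n$-dimensional affine space over $\mathbb{F}_q$: a $k$-flat is a coset $P+x$ of a $k$-dimensional subspace $P$ of $\mathbb{F}_q^n$, and its dimension is $\dim P$. $\mathcal{M}(k,n)$ denotes the set of all $k$-flats. The intersection of two flats is either a flat or empty; the empty set is regarded as having dimension smaller than every nonnegative integer. Families $\mathcal{F}_1\subseteq\mathcal{M}(k_1,n)$ and $\mathcal{F}_2\subseteq\mathcal{M}(k_2,n)$ are cross $t$-intersecting if $\dim(F_1\cap F_2)\ge t$ for all $F_1\in\mathcal{F}_1$, $F_2\in\mathcal{F}_2$. *)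

(* Defs.v *)
From mathcomp Require Import all_boot all_order all_algebra.

Set Implicit Arguments.
Unset Strict Implicit.
Unset Printing Implicit Defensive.

Local Open Scope ring_scope.

Section AffineFlats.

Variables (F : finFieldType) (n : nat).

Implicit Types (A : {set 'rV[F]_n}) (Fam : {set {set 'rV[F]_n}}).

Definition coset_of_vspace (P : {vspace 'rV[F]_n}) (x : 'rV[F]_n) :
    {set 'rV[F]_n} :=
  [set p + x | p : 'rV[F]_n & p \in P].

Definition is_flat (k : nat) A : Prop :=
  exists P : {vspace 'rV[F]_n}, exists x : 'rV[F]_n,
    \dim P = k /\ A = coset_of_vspace P x.

(* The empty set is not a flat, so it fails [flat_dim_ge t] for every [t]. *)
Definition flat_dim_ge (t : nat) A : Prop :=
  exists m : nat, (t <= m)%N /\ is_flat m A.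

Definition flat_family (k : nat) Fam : Prop :=
  forall A, A \in Fam -> is_flat k A.

Definition cross_intersecting (t : nat) Fam1 Fam2 : Prop :=
  forall A B, A \in Fam1 -> B \in Fam2 -> flat_dim_ge t (A :&: B).

End AffineFlats.

(* Main.v *)
Require Import Defs.
From mathcomp Require Import all_boot all_order all_algebra.
From mathcomp Require Import finfield ring lra zify.

(** Say that T covers F1 if dim (A :&: T) is at least t for all A in F1, and
    let s1, s2 be the least dimensions of flats covering F1, F2.  Each member
    of F1 contains a t-flat of a least cover of F1, so |F1| is at most the
    number of t-flats in an s1-flat times the largest number of members of F1
    through a t-flat.  A flat S of dimension below s2 does not cover F2, so it
    meets some B in F2 in few points, while all members of F1 meet B in many.
    Counting the pairs (A, x) with A in F1 through S and x in (A :&: B) :\: S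
    bounds the number of such A by a constant times the largest number of
    members through a flat one dimension larger.  Doing so from dimension t up
    to s2 bounds |F1|, and |F2| is bounded symmetrically.  As n >= k1 + k2 + 3,
    the product of the two bounds strictly decreases in s1 and in s2, and its
    value at s1 = s2 = t is reached by all flats through a fixed t-flat.  Hence
    s1 = s2 = t, and F1 consists of all k1-flats through some t-flat T.  A
    member of F2 not containing T would allow one more counting step, whose
    bound on |F1| is too small. *)

Set Implicit Arguments.
Unset Strict Implicit.
Unset Printing Implicit Defensive.

Import Order.TTheory GRing.Theory Num.Theory.

Section Stars.

Variable T : finType.

Implicit Types (A B S : {set T}) (G : {set {set T}}).

Definition star G S := [set A in G | S \subset A].

Lemma in_star G S A : (A \in star G S) = (A \in G) && (S \subset A).
Proof. by rewrite inE. Qed.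

Lemma in_ssetI G A B : (A \in G ::&: B) = (A \in G) && (A \subset B).
Proof. by rewrite inE. Qed.

Lemma star0 G : star G set0 = G.
Proof. by apply/setP => A; rewrite in_star sub0set andbT. Qed.

Lemma sum_card_star_trace G S B :
  \sum_(A in star G S) #|(A :&: B) :\: S| =
  \sum_(x in B :\: S) #|star G (x |: S)|.
Proof.
have traceE A : #|(A :&: B) :\: S| = \sum_(x in B :\: S) (x \in A).
  rewrite -sum1_card -big_mkcondr /=; apply: eq_bigl => x.
  by rewrite !inE [_ && (x \in B)]andbC andbA.
under eq_bigr do rewrite traceE.
rewrite exchange_big; apply: eq_bigr => x _.
rewrite -sum1_card -big_mkcondr; apply: eq_bigl => A /=.
by rewrite !in_star subUset sub1set -andbA [(x \in A) && _]andbC.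
Qed.

Lemma card_star_trace_eq (R : pzSemiRingType) G S B (a b : R) :
    {in star G S, forall A, #|(A :&: B) :\: S|%:R = a}%R ->
    {in B :\: S, forall x, #|star G (x |: S)|%:R = b}%R ->
  (#|star G S|%:R * a = #|B :\: S|%:R * b)%R.
Proof.
move=> traceE starE; rewrite !mulr_natl -!sumr_const -(eq_bigr _ traceE).
by rewrite -natr_sum sum_card_star_trace natr_sum (eq_bigr _ starE).
Qed.

Lemma card_star_trace_le (R : numDomainType) G S B (a b : R) :
    {in star G S, forall A, a <= #|(A :&: B) :\: S|%:R}%R ->
    {in B :\: S, forall x, #|star G (x |: S)|%:R <= b}%R ->
  (#|star G S|%:R * a <= #|B :\: S|%:R * b)%R.
Proof.
move=> trace_ge star_le; rewrite !mulr_natl -!sumr_const.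
apply: (@le_trans _ _ (\sum_(A in star G S) #|(A :&: B) :\: S|)%:R%R).
  by rewrite natr_sum ler_sum.
by rewrite sum_card_star_trace natr_sum ler_sum.
Qed.

Lemma card_bigcup_le (I : finType) (P : pred I) (f : I -> {set T}) :
  #|\bigcup_(i | P i) f i| <= \sum_(i | P i) #|f i|.
Proof.
elim/big_rec2: _ => [|i m U _ leUm]; first by rewrite cards0.
by rewrite (leq_trans (leq_card_setU _ _)) // leq_add2l.
Qed.

End Stars.

Section GaussianCoefficients.

Local Open Scope ring_scope.

Variables (R : realFieldType) (q : R).
Hypothesis q_ge2 : 2 <= q.

Let q_gt1 : 1 < q. Proof. by apply: lt_le_trans q_ge2; rewrite ltr1n. Qed.

Let q_gt0 : 0 < q. Proof. exact: lt_trans q_gt1. Qed.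

Let expq_gt0 i : 0 < q ^+ i. Proof. exact: exprn_gt0. Qed.

(* The Gaussian binomial coefficient [m - s, k - s]_q. *)
Definition nbetween s k m : R :=
  \prod_(s <= i < k) ((q ^+ m - q ^+ i) / (q ^+ k - q ^+ i)).

Definition nwithin k m : R := q ^+ m / q ^+ k * nbetween 0 k m.

Lemma nbetweennn k m : nbetween k k m = 1.
Proof. by rewrite /nbetween big_geq. Qed.

Lemma nbetween_recl s k m : (s < k)%N ->
  nbetween s k m = (q ^+ m - q ^+ s) / (q ^+ k - q ^+ s) * nbetween s.+1 k m.
Proof. exact: big_ltn. Qed.

Lemma nbetween_gt0 s k m : (k <= m)%N -> 0 < nbetween s k m.
Proof.
move=> km; rewrite /nbetween big_nat_cond prodr_gt0 // => i.
case/andP=> /andP[_ ik] _.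
by rewrite divr_gt0 // subr_gt0 ltr_eXn2l // (leq_trans ik).
Qed.

Lemma nbetween_growth s k m : (s < k <= m)%N ->
  q ^+ (m - k) * nbetween s.+1 k m <= nbetween s k m.
Proof.
case/andP=> sk km; rewrite [leRHS]nbetween_recl //.
apply: ler_wpM2r; first by rewrite ltW // nbetween_gt0.
rewrite ler_pdivlMr ?subr_gt0 ?ltr_eXn2l // mulrBr -!exprD subnK //.
by rewrite lerD2l lerN2 ler_eXn2l // leq_addl.
Qed.

Lemma nwithin_gt0 t m : (t <= m)%N -> 0 < nwithin t m.
Proof. by move=> tm; rewrite mulr_gt0 ?divr_gt0 ?nbetween_gt0. Qed.

Lemma nwithinnn t : nwithin t t = 1.
Proof.
rewrite /nwithin divff ?gt_eqF // mul1r /nbetween big_nat.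
rewrite big1 // => i /andP[_ it].
by rewrite divff // subr_eq0 gt_eqF // ltr_eXn2l.
Qed.

Lemma nbetween0S t m : (t <= m)%N ->
  nbetween 0 t m.+1 * (q ^+ (m.+1 - t) - 1) = (q ^+ m.+1 - 1) * nbetween 0 t m.
Proof.
rewrite /nbetween !prodf_div mulrAC [RHS]mulrA => tm; congr (_ / _).
elim: t tm => [|t IH] tm; first by rewrite !big_geq // mul1r mulr1.
rewrite 2?big_nat_recr //= [RHS]mulrA.
rewrite -IH; last exact: ltnW.
rewrite subSS subSn; last exact: ltnW.
have qm : q ^+ m = q ^+ t * q ^+ (m - t) by rewrite -exprD subnKC // ltnW.
rewrite exprS [q ^+ (m - t).+1]exprS qm.
by ring.
Qed.

Lemma nwithinS t m : (t <= m)%N ->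
  nwithin t m.+1 * (q ^+ (m.+1 - t) - 1) = q * (q ^+ m.+1 - 1) * nwithin t m.
Proof. by move=> tm; rewrite /nwithin -mulrA nbetween0S // exprS; ring. Qed.

Lemma nwithinS_lt t m : (t <= m)%N ->
  nwithin t m.+1 < q ^+ t.+2 * (q - 1) * nwithin t m.
Proof.
move=> tm.
have d_gt0 : 0 < q ^+ (m.+1 - t) - 1 by rewrite subr_gt0 exprn_egt1 // subSn.
rewrite -(ltr_pM2r d_gt0) nwithinS // [ltRHS]mulrAC ltr_pM2r ?nwithin_gt0 //.
rewrite subSn // -[m in q ^+ m.+1](subnKC tm) -addSn exprD !(exprS q _.+1).
rewrite [q ^+ (m - t).+1]exprS -!mulrA ltr_pM2l //.
have v_ge1 : 1 <= q ^+ (m - t) by rewrite exprn_ege1 // ltW.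
move: (q ^+ t.+1) (q ^+ (m - t)) (expq_gt0 t.+1) v_ge1 q_ge2 => u v u0 v1 q2.
have v_le : v <= q * v - 1 by nra.
have v_le_prod : v <= (q - 1) * (q * v - 1) by nra.
by have := ler_wpM2l (ltW u0) v_le_prod; lra.
Qed.

(* A k-flat B has at most q^k points outside S; if S has fewer than q^t points
   in B, then a flat with at least q^t points in B has at least q^t - q^t / q
   of them outside S. *)
Definition loss k t : R := q ^+ k / (q ^+ t - q ^+ t / q).

Lemma loss_den_gt0 t : 0 < q ^+ t - q ^+ t / q.
Proof. by rewrite subr_gt0 ltr_pdivrMr ?ltr_pMr. Qed.

Lemma loss_gt0 k t : 0 < loss k t.
Proof. by rewrite divr_gt0 ?loss_den_gt0. Qed.

(* The factor depending on s in the product of the bounds on the two families,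
   where s is the least dimension of a cover of one of them. *)
Definition cover_cost t k' k m s : R :=
  nwithin t s * (loss k' t ^+ (s - t) * nbetween s k m).

Lemma cover_costnn t k' k m : cover_cost t k' k m t = nbetween t k m.
Proof. by rewrite /cover_cost nwithinnn subnn !mul1r. Qed.

Lemma cover_cost_gt0 t k' k m s : (t <= s)%N -> (k <= m)%N ->
  0 < cover_cost t k' k m s.
Proof.
move=> ts km; apply: mulr_gt0; first exact: nwithin_gt0.
by rewrite mulr_gt0 ?exprn_gt0 ?loss_gt0 ?nbetween_gt0.
Qed.

Lemma expq_loss k t : q ^+ (k + 3) = q ^+ t.+2 * (q - 1) * loss k t.
Proof.
rewrite /loss exprD !exprS; field.
by rewrite subr_eq0 !gt_eqF ?ltr_pMr.
Qed.

Lemma loss_nbetween_le t k' k m s : (s < k)%N -> (k + k' + 3 <= m)%N ->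
  q ^+ t.+2 * (q - 1) * (loss k' t * nbetween s.+1 k m) <= nbetween s k m.
Proof.
move=> sk le_m; rewrite mulrA -expq_loss.
apply: le_trans (nbetween_growth _); last by rewrite sk; lia.
by apply: ler_wpM2r; rewrite ?ler_eXn2l ?ltW ?nbetween_gt0 //; lia.
Qed.

Lemma cover_costS_lt t k' k m s : (t <= s < k)%N -> (k + k' + 3 <= m)%N ->
  cover_cost t k' k m s.+1 < cover_cost t k' k m s.
Proof.
case/andP=> ts sk le_m; have km : (k <= m)%N by lia.
rewrite /cover_cost subSn // exprSr -mulrA.
have L_gt0 : 0 < loss k' t ^+ (s - t) by rewrite exprn_gt0 ?loss_gt0.
apply: (@lt_le_trans _ _ (q ^+ t.+2 * (q - 1) * nwithin t s *
    (loss k' t ^+ (s - t) * (loss k' t * nbetween s.+1 k m)))).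
  rewrite ltr_pM2r ?nwithinS_lt // mulr_gt0 //.
  by rewrite mulr_gt0 ?loss_gt0 ?nbetween_gt0.
rewrite [_ * nwithin t s]mulrC mulrACA [leRHS]mulrA.
by rewrite ler_pM2l ?loss_nbetween_le // mulr_gt0 ?nwithin_gt0.
Qed.

Lemma cover_cost_lt t k' k m s : (t < s <= k)%N -> (k + k' + 3 <= m)%N ->
  cover_cost t k' k m s < nbetween t k m.
Proof.
elim: s => // s IH /andP[]; rewrite ltnS leq_eqVlt => /orP[/eqP<-|ts] sk le_m.
  by rewrite -(cover_costnn t k') cover_costS_lt ?leqnn.
apply: lt_trans (IH _ le_m); last by rewrite ts ltnW.
by rewrite cover_costS_lt ?(ltnW ts).
Qed.

Lemma cover_cost_le t k' k m s : (t <= s <= k)%N -> (k + k' + 3 <= m)%N ->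
  cover_cost t k' k m s <= nbetween t k m.
Proof.
rewrite leq_eqVlt => /andP[/orP[/eqP<-|ts] sk le_m].
  by rewrite cover_costnn.
by rewrite ltW // cover_cost_lt ?ts.
Qed.

Lemma loss_nbetween_lt t k' k m s : (s < k)%N -> (k + k' + 3 <= m)%N ->
  loss k' t * nbetween s.+1 k m < nbetween s k m.
Proof.
move=> sk le_m; apply: lt_le_trans (loss_nbetween_le t sk le_m).
have x_gt0 : 0 < loss k' t * nbetween s.+1 k m.
  by rewrite mulr_gt0 ?loss_gt0 ?nbetween_gt0 //; lia.
have q2_gt1 : 1 < q ^+ t.+2 by rewrite exprn_egt1.
rewrite ltr_pMl // (lt_le_trans q2_gt1) // ler_peMr ?(ltW (expq_gt0 _)) //.
by rewrite lerBrDr.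
Qed.

End GaussianCoefficients.

Lemma dimv_add_line (K : fieldType) (vT : vectType K) (v : vT)
    (U : {vspace vT}) : v \notin U -> \dim (<[v]> + U) = (\dim U).+1.
Proof.
move=> vU; have : free (v :: vbasis U).
  by rewrite free_cons (span_basis (vbasisP U)) vU (basis_free (vbasisP U)).
by move/eqP; rewrite span_cons (span_basis (vbasisP U)) /= size_tuple.
Qed.

Section Flats.

Variables (F : finFieldType) (n : nat).

Local Notation V := 'rV[F]_n.
Local Notation q := #|F|.

Implicit Types (A B M R S T : {set V}) (G : {set {set V}}) (P Q : {vspace V}).

Let q_gt1 : 1 < q. Proof. exact: finNzRing_gt1. Qed.

Let expq_gt0 i : 0 < q ^ i. Proof. by rewrite expn_gt0 ltnW. Qed.

Lemma mem_coset P (x y : V) : (y \in coset_of_vspace P x) = (y - x \in P)%R.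
Proof.
apply/imsetP/idP => [[p + ->] | yxP]; first by rewrite addrK inE.
by exists (y - x)%R; rewrite ?inE ?subrK.
Qed.

Lemma coset_refl P (x : V) : x \in coset_of_vspace P x.
Proof. by rewrite mem_coset subrr mem0v. Qed.

Lemma coset_rebase P (x y : V) :
  y \in coset_of_vspace P x -> coset_of_vspace P x = coset_of_vspace P y.
Proof.
rewrite mem_coset => yxP; apply/setP => z; rewrite !mem_coset.
by rewrite -[(z - x)%R](subrKA y) rpredDr.
Qed.

Lemma coset_subset P Q (x : V) :
  (coset_of_vspace P x \subset coset_of_vspace Q x) = (P <= Q)%VS.
Proof.
apply/subsetP/subvP => PQ y; last by rewrite !mem_coset; apply: PQ.
by have := PQ (y + x)%R; rewrite !mem_coset addrK.
Qed.

Lemma card_coset P (x : V) : #|coset_of_vspace P x| = q ^ \dim P.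
Proof.
rewrite card_imset; last exact: addIr.
rewrite -(card_vspace (P : {vspace Vector.Pack (Vector.class V)})).
by apply: eq_card => v; rewrite inE.
Qed.

(* Subspaces do not form a finType: a flat is given by a point and a basis of
   its direction. *)
Definition flats k : {set {set V}} :=
  [set A | [exists x : V, exists X : k.-tuple V,
     free X && (A == coset_of_vspace <<X>> x)]].

Lemma flatsP k A : reflect (is_flat k A) (A \in flats k).
Proof.
rewrite inE; apply: (iffP existsP) => [[x /existsP[X]] | [P [x [<- ->]]]].
  case/andP=> /eqP dimX /eqP ->.
  by exists <<X>>%VS, x; rewrite dimX size_tuple.
exists x; apply/existsP; exists (vbasis P).
by rewrite (basis_free (vbasisP P)) (span_basis (vbasisP P)) eqxx.
Qed.

Lemma flat_familyP k G : reflect (flat_family k G) (G \subset flats k).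
Proof. by apply: (iffP subsetP) => fG A /fG /flatsP. Qed.

Lemma coset_in_flats P (x : V) : coset_of_vspace P x \in flats (\dim P).
Proof. by apply/flatsP; exists P, x. Qed.

Lemma flats_coset k A (x : V) : A \in flats k -> x \in A ->
  exists2 P, \dim P = k & A = coset_of_vspace P x.
Proof. by move=> /flatsP[P [y [<- ->]]] /coset_rebase ->; exists P. Qed.

Lemma card_flat k A : A \in flats k -> #|A| = q ^ k.
Proof. by case/flatsP=> P [x [<- ->]]; rewrite card_coset. Qed.

Lemma flat_sub_eq k A B :
  A \in flats k -> B \in flats k -> A \subset B -> A = B.
Proof.
move=> fA fB AB; apply/eqP.
by rewrite eqEcard AB (card_flat fA) (card_flat fB) leqnn.
Qed.

Lemma set1_in_flats (x : V) : [set x] \in flats 0.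
Proof.
apply/flatsP; exists 0%VS, x; split; first exact: dimv0.
by apply/setP => y; rewrite mem_coset memv0 subr_eq0 inE.
Qed.

Lemma setT_in_flats : [set: V] \in flats n.
Proof.
apply/flatsP; exists fullv, 0%R; split; first by rewrite dimvf /dim /= mul1n.
by apply/setP => y; rewrite mem_coset memvf inE.
Qed.

Lemma flatI_in_flats a b A B : A \in flats a -> B \in flats b ->
  A :&: B != set0 -> exists j, A :&: B \in flats j.
Proof.
move=> fA fB /set0Pn[x /setIP[xA xB]].
have [P _ ->] := flats_coset fA xA; have [Q _ ->] := flats_coset fB xB.
exists (\dim (P :&: Q)); apply/flatsP; exists (P :&: Q)%VS, x; split=> //.
by apply/setP => y; rewrite inE !mem_coset memv_cap.
Qed.

Lemma flat_dim_geP a b t A B : A \in flats a -> B \in flats b ->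
  reflect (flat_dim_ge t (A :&: B)) (q ^ t <= #|A :&: B|).
Proof.
move=> fA fB; apply: (iffP idP) => [tAB |]; last first.
  by case=> m [tm /flatsP/card_flat ->]; rewrite leq_exp2l.
have [|j fj] := flatI_in_flats fA fB.
  by rewrite -card_gt0 (leq_trans _ tAB).
exists j; split; last exact/flatsP.
by rewrite -(leq_exp2l _ _ q_gt1) -(card_flat fj).
Qed.

Lemma card_flatI_lt a b t A B : A \in flats a -> B \in flats b ->
  #|A :&: B| < q ^ t -> #|A :&: B| * q <= q ^ t.
Proof.
move=> fA fB; have [-> _ | AB0] := eqVneq (A :&: B) set0.
  by rewrite cards0.
have [j /card_flat ->] := flatI_in_flats fA fB AB0.
by rewrite -expnSr ltn_exp2l // leq_exp2l.
Qed.

Lemma flat_join s S (x : V) : S \in flats s -> x \notin S ->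
  exists2 S', S' \in flats s.+1 &
    forall k A, A \in flats k -> (S' \subset A) = (x |: S \subset A).
Proof.
case/flatsP=> P [y [<- ->]]; rewrite mem_coset => xyP.
exists (coset_of_vspace (<[x - y]> + P)%VS y).
  by rewrite -(dimv_add_line xyP) coset_in_flats.
move=> k A fA; rewrite subUset sub1set.
have [yA | yA] := boolP (y \in A); last first.
  have not_sub U : coset_of_vspace U y \subset A = false.
    by apply: contraNF yA => /subsetP; apply; apply: coset_refl.
  by rewrite !not_sub andbF.
have [Q _ ->] := flats_coset fA yA.
by rewrite !coset_subset subv_add -memvE mem_coset.
Qed.

Lemma star_join G k S S' (x : V) : G \subset flats k ->
    (forall A, A \in flats k -> (S' \subset A) = (x |: S \subset A)) ->
  star G (x |: S) = star G S'.
Proof.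
move=> /subsetP fG S'E; apply/setP => A; rewrite !in_star.
by have [/fG/S'E-> | _] := boolP (A \in G).
Qed.

Lemma subflat_exists k m M : M \in flats m -> k <= m ->
  exists2 S, S \in flats k & S \subset M.
Proof.
move=> fM; elim: k => [|k IH] km.
  have /card_gt0P[x xM] : 0 < #|M| by rewrite (card_flat fM).
  by exists [set x]; rewrite ?set1_in_flats ?sub1set.
have [S fS SM] := IH (ltnW km).
have /properP[_ [x xM xS]] : S \proper M.
  by rewrite properEcard SM (card_flat fS) (card_flat fM) ltn_exp2l.
have [S' fS' S'E] := flat_join fS xS.
by exists S'; rewrite // (S'E _ _ fM) subUset sub1set xM.
Qed.

Local Open Scope ring_scope.

Local Notation Q := (q%:R : rat).

Let Q_ge2 : 2 <= Q. Proof. by rewrite (ler_nat _ 2). Qed.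

Let Q_gt1 : 1 < Q. Proof. by rewrite ltr1n. Qed.

Lemma card_flatD s k A S : A \in flats k -> S \in flats s -> S \subset A ->
  #|A :\: S|%:R = Q ^+ k - Q ^+ s.
Proof.
move=> fA fS SA; rewrite cardsD (setIidPr SA) natrB ?subset_leq_card //.
by rewrite (card_flat fA) (card_flat fS) !natrX.
Qed.

Lemma card_flats_between s k m S M : S \in flats s -> M \in flats m ->
    S \subset M -> (s <= k <= m)%N ->
  #|star (flats k ::&: M) S|%:R = nbetween Q s k m.
Proof.
move=> + fM + /andP[sk km]; move: {2}(k - s)%N (erefl (k - s)%N) => d.
elim: d s S sk => [|d IH] s S sk dE fS SM.
  have {dE sk} ks : s = k by lia.
  rewrite ks in fS *; rewrite nbetweennn.
  have -> : star (flats k ::&: M) S = [set S]; last by rewrite cards1.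
  apply/setP => A; rewrite in_star in_ssetI in_set1.
  apply/andP/eqP => [[/andP[fA _] SA]| ->]; last by rewrite fS SM.
  by rewrite (flat_sub_eq fS fA SA).
have {}sk : (s < k)%N by lia.
have d_neq0 : Q ^+ k - Q ^+ s != 0 by rewrite subr_eq0 gt_eqF // ltr_eXn2l.
apply: (mulIf d_neq0); rewrite nbetween_recl // mulrAC divfK //.
rewrite -(card_flatD fM fS SM); apply: card_star_trace_eq => [A|x].
  rewrite in_star in_ssetI => /andP[/andP[fA AM] SA].
  by rewrite (setIidPl AM) (card_flatD fA fS SA).
move=> /setDP[xM xS]; have [S' fS' S'E] := flat_join fS xS.
have sub : flats k ::&: M \subset flats k by rewrite -setI_powerset subsetIl.
rewrite (star_join sub (S'E k)) (IH s.+1) ?subnS ?dE //.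
by rewrite (S'E _ _ fM) subUset sub1set xM.
Qed.

Lemma card_subflats k m M : M \in flats m -> (k <= m)%N ->
  #|flats k ::&: M|%:R = nwithin Q k m.
Proof.
move=> fM km; have Qk_neq0 : Q ^+ k != 0.
  by rewrite expf_neq0 // gt_eqF // (lt_trans ltr01).
have cardM : #|M :\: set0|%:R = Q ^+ m by rewrite setD0 (card_flat fM) natrX.
apply: (mulIf Qk_neq0); rewrite /nwithin mulrAC divfK //.
rewrite -cardM -(star0 (_ ::&: _)).
apply: card_star_trace_eq => [A|x].
  rewrite star0 in_ssetI => /andP[fA AM].
  by rewrite setD0 (setIidPl AM) (card_flat fA) natrX.
rewrite setD0 setU0 => xM.
by rewrite (card_flats_between (set1_in_flats x) fM) ?sub1set.
Qed.

Lemma card_star_flats s k S : S \in flats s -> (s <= k <= n)%N ->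
  #|star (flats k) S|%:R = nbetween Q s k n.
Proof.
move=> fS skn; rewrite -(card_flats_between fS setT_in_flats) //.
by congr (#|star _ _|%:R); apply/setP => A; rewrite in_ssetI subsetT andbT.
Qed.

Lemma card_star_le G s k S : G \subset flats k -> S \in flats s ->
  (s <= k <= n)%N -> #|star G S|%:R <= nbetween Q s k n.
Proof.
move=> fG fS skn; rewrite -(card_star_flats fS skn) ler_nat subset_leq_card //.
by apply/subsetP => A; rewrite !in_star => /andP[/(subsetP fG)-> ->].
Qed.

Definition cover t G T := [forall A in G, (q ^ t <= #|A :&: T|)%N].

Definition mincover t G s T :=
  [/\ T \in flats s, cover t G T &
      forall j R, R \in flats j -> cover t G R -> (s <= j)%N].

Lemma mincover_exists t G b B : B \in flats b -> cover t G B ->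
  exists s T, mincover t G s T.
Proof.
move=> fB cB; pose has_cover s := [exists T in flats s, cover t G T].
have exP : exists s, has_cover s by exists b; apply/exists_inP; exists B.
case: (ex_minnP exP) => s /exists_inP[T fT cT] min_s.
by exists s, T; split=> // j R fR cR; apply: min_s; apply/exists_inP; exists R.
Qed.

Lemma cover_dim_ge t G s T : G != set0 -> T \in flats s -> cover t G T ->
  (t <= s)%N.
Proof.
move=> /set0Pn[A AG] fT /forall_inP/(_ A AG) tAT.
rewrite -(leq_exp2l _ _ q_gt1) -(card_flat fT) (leq_trans tAT) //.
exact/subset_leq_card/subsetIr.
Qed.

Lemma cover_flat_sub t G T A : T \in flats t -> cover t G T -> A \in G ->
  T \subset A.
Proof.
move=> fT /forall_inP cT AG; have : A :&: T == T.
  by rewrite eqEcard subsetIr (card_flat fT) cT.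
by move/eqP <-; exact: subsetIl.
Qed.

Lemma card_cover_le k t s G T (X : rat) :
    G \subset flats k -> T \in flats s -> (t <= s)%N -> cover t G T ->
    (forall R, R \in flats t -> #|star G R|%:R <= X) ->
  #|G|%:R <= nwithin Q t s * X.
Proof.
move=> /subsetP fG fT ts /forall_inP cT leX.
have /subset_leq_card sub : G \subset \bigcup_(R in flats t ::&: T) star G R.
  apply/subsetP => A AG; have tAT := cT A AG.
  have [|j fAT] := flatI_in_flats (fG A AG) fT.
    by rewrite -card_gt0 (leq_trans _ tAT).
  have tj : (t <= j)%N by rewrite -(leq_exp2l _ _ q_gt1) -(card_flat fAT).
  have [R fR] := subflat_exists fAT tj; rewrite subsetI => /andP[RA RT].
  by apply/bigcupP; exists R; rewrite ?in_ssetI ?in_star ?fR ?AG.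
rewrite -(card_subflats fT ts) mulr_natl -[leRHS]sumr_const.
apply: (@le_trans _ _ (\sum_(R in flats t ::&: T) #|star G R|)%:R).
  by rewrite ler_nat (leq_trans sub) // card_bigcup_le.
by rewrite natr_sum; apply: ler_sum => R; rewrite in_ssetI => /andP[/leX].
Qed.

Lemma card_star_le_loss k k' t s G B S (X : rat) :
    G \subset flats k -> B \in flats k' -> cover t G B ->
    S \in flats s -> (#|S :&: B| < q ^ t)%N -> 0 <= X ->
    (forall S', S' \in flats s.+1 -> #|star G S'|%:R <= X) ->
  #|star G S|%:R <= loss Q k' t * X.
Proof.
move=> fG fB /forall_inP cB fS SB X_ge0 leX.
have SB_le : #|S :&: B|%:R <= Q ^+ t / Q.
  rewrite ler_pdivlMr ?(lt_trans ltr01) // -natrX -natrM ler_nat.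
  exact: card_flatI_lt fS fB SB.
rewrite /loss mulrAC ler_pdivlMr ?loss_den_gt0 //.
apply: (@le_trans _ _ (#|B :\: S|%:R * X)); last first.
  rewrite ler_wpM2r // -natrX -(card_flat fB) ler_nat subset_leq_card //.
  exact: subsetDl.
apply: card_star_trace_le => [A|x /setDP[_ xS]].
  rewrite in_star => /andP[AG SA].
  rewrite cardsD setIAC (setIidPr SA) natrB ?subset_leq_card ?setSI //.
  by rewrite lerB // -natrX ler_nat cB.
by have [S' fS' S'E] := flat_join fS xS; rewrite (star_join fG (S'E k)) leX.
Qed.

Definition cross t G G' := [forall B in G', cover t G B].

Lemma cross_cover t G G' B : cross t G G' -> B \in G' -> cover t G B.
Proof. by move/forall_inP; apply. Qed.

Lemma crossC t G G' : cross t G G' = cross t G' G.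
Proof.
by apply/forall_inP/forall_inP => cr A AG; apply/forall_inP => B BG;
  rewrite setIC; move/forall_inP: (cr B BG); apply.
Qed.

Lemma crossP k k' t G G' : G \subset flats k -> G' \subset flats k' ->
  reflect (cross_intersecting t G G') (cross t G G').
Proof.
move=> /subsetP fG /subsetP fG'; apply: (iffP forall_inP) => cr.
  move=> A B AG BG'; apply/(flat_dim_geP _ (fG A AG) (fG' B BG')).
  by move/forall_inP: (cr B BG'); apply.
move=> B BG'; apply/forall_inP => A AG.
by apply/(flat_dim_geP _ (fG A AG) (fG' B BG'))/cr.
Qed.

Lemma card_star_le_loss_exp k k' t m s G G' S T :
    G \subset flats k -> G' \subset flats k' -> cross t G G' ->
    mincover t G' m T ->
    S \in flats s -> (s <= m <= k)%N -> (k <= n)%N ->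
  #|star G S|%:R <= loss Q k' t ^+ (m - s) * nbetween Q m k n.
Proof.
move=> fG /subsetP fG' cr [_ _ min_m] + /andP[sm mk] kn.
move: {2}(m - s)%N (erefl (m - s)%N) => d.
elim: d s S sm => [|d IH] s S sm dE fS.
  have ms : s = m by lia.
  by rewrite ms subnn mul1r in fS *; rewrite card_star_le ?mk.
have [B BG' BS] : exists2 B, B \in G' & (#|S :&: B| < q ^ t)%N.
  have /forall_inPn[B BG'] : ~~ cover t G' S.
    by apply/negP => /(min_m _ _ fS); lia.
  by rewrite -ltnNge setIC; exists B.
rewrite dE exprS -mulrA.
have cB := cross_cover cr BG'.
apply: (card_star_le_loss fG (fG' B BG') cB fS BS) => [|S' fS'].
  by rewrite mulr_ge0 ?exprn_ge0 ?ltW ?loss_gt0 ?nbetween_gt0.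
have dE' : (m - s.+1)%N = d by rewrite subnS dE.
by rewrite -dE' IH // -subn_gt0 dE.
Qed.

Lemma card_mincover_le k k' t s s' G G' T T' :
    G \subset flats k -> G' \subset flats k' -> cross t G G' ->
    mincover t G s T -> mincover t G' s' T' ->
    (t <= s)%N -> (t <= s' <= k)%N -> (k <= n)%N ->
  #|G|%:R <= nwithin Q t s * (loss Q k' t ^+ (s' - t) * nbetween Q s' k n).
Proof.
move=> fG fG' cr [fT cT _] mT' ts ts'k kn.
apply: (card_cover_le fG fT ts cT) => R fR.
exact: (card_star_le_loss_exp fG fG' cr mT').
Qed.

Definition large_cross_pair k k' t G G' :=
  [/\ G \subset flats k, G' \subset flats k', cross t G G' &
      nbetween Q t k n * nbetween Q t k' n <= #|G|%:R * #|G'|%:R].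

Lemma large_cross_pairC k k' t G G' :
  large_cross_pair k k' t G G' -> large_cross_pair k' k t G' G.
Proof.
by case=> fG fG' cr large; split; rewrite 1?crossC // mulrC [leRHS]mulrC.
Qed.

Lemma large_cross_pair_neq0 k k' t G G' : (k <= n)%N -> (k' <= n)%N ->
  large_cross_pair k k' t G G' -> G != set0.
Proof.
move=> kn k'n [_ _ _]; apply: contraTneq => ->.
by rewrite cards0 mul0r -ltNge mulr_gt0 ?nbetween_gt0.
Qed.

Lemma mincover_dim_bounds k k' t s G G' T : (k <= n)%N -> (k' <= n)%N ->
  large_cross_pair k k' t G G' -> mincover t G s T -> (t <= s <= k')%N.
Proof.
move=> kn k'n large [fT cT min_s].
rewrite (cover_dim_ge (large_cross_pair_neq0 kn k'n large) fT cT) /=.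
have /set0Pn[B BG'] := large_cross_pair_neq0 k'n kn (large_cross_pairC large).
have [_ /subsetP fG' cr _] := large.
exact: (min_s _ _ (fG' B BG') (cross_cover cr BG')).
Qed.

Lemma large_cross_pair_mincover_dim k k' t s s' G G' T T' :
    (k + k' + 3 <= n)%N -> large_cross_pair k k' t G G' ->
    mincover t G s T -> mincover t G' s' T' ->
  s = t.
Proof.
move=> le_n large mT mT'; have [fG fG' cr ge] := large.
have [kn k'n le_n'] : [/\ k <= n, k' <= n & k' + k + 3 <= n]%N by split; lia.
have ts := mincover_dim_bounds kn k'n large mT.
have ts' := mincover_dim_bounds k'n kn (large_cross_pairC large) mT'.
have [[t_le_s _] [t_le_s' _]] := (andP ts, andP ts').
have cr' : cross t G' G by rewrite crossC.
have leG := card_mincover_le fG fG' cr mT mT' t_le_s ts' kn.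
have leG' := card_mincover_le fG' fG cr' mT' mT t_le_s' ts k'n.
have le_cost : #|G|%:R * #|G'|%:R <=
    cover_cost Q t k' k n s' * cover_cost Q t k k' n s.
  apply: le_trans (ler_pM _ _ leG leG') _ => //.
  by rewrite /cover_cost mulrACA [leRHS]mulrACA (mulrC (nwithin Q t s)).
apply/eqP; rewrite eqn_leq t_le_s andbT leqNgt; apply: contraL ge => t_lt_s.
rewrite -ltNge (le_lt_trans le_cost) //.
apply: (@le_lt_trans _ _ (nbetween Q t k n * cover_cost Q t k k' n s)).
  by rewrite ler_wpM2r ?cover_cost_le // ltW ?cover_cost_gt0.
by rewrite ltr_pM2l ?nbetween_gt0 // cover_cost_lt // t_lt_s; case/andP: ts.
Qed.

Lemma star_flat_cover t G T : T \in flats t -> cover t G T -> star G T = G.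
Proof.
move=> fT cT; apply/setP => A; rewrite in_star andb_idr // => AG.
exact: cover_flat_sub fT cT AG.
Qed.

Lemma full_star_cover_subset k k' t G T B :
    (t <= k)%N -> (k + k' + 3 <= n)%N -> G \subset flats k -> G != set0 ->
    T \in flats t -> cover t G T -> nbetween Q t k n <= #|G|%:R ->
    B \in flats k' -> cover t G B -> T \subset B.
Proof.
move=> tk le_n fG /set0Pn[A AG] fT cT ge fB cB.
have kn : (k <= n)%N by rewrite (leq_trans _ le_n) // -addnA leq_addr.
have [TB | TB] := leqP (q ^ t) #|T :&: B|.
  suff /eqP <- : T :&: B == T by apply: subsetIr.
  by rewrite eqEcard subsetIl (card_flat fT).
have {}tk : (t < k)%N.
  rewrite ltn_neqAle tk andbT; apply: contraTneq TB => tk_eq.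
  rewrite -leqNgt; have <- : A = T; last by move/forall_inP: cB; apply.
  apply/esym/(flat_sub_eq fT); last exact: cover_flat_sub fT cT AG.
  by rewrite tk_eq (subsetP fG).
have leG : #|G|%:R <= loss Q k' t * nbetween Q t.+1 k n.
  rewrite -(star_flat_cover fT cT).
  apply: (card_star_le_loss fG fB cB fT TB) => [|S fS].
    by rewrite ltW ?nbetween_gt0.
  by rewrite card_star_le ?tk.
by move: (le_lt_trans leG (loss_nbetween_lt Q_ge2 t tk le_n)); rewrite ltNge ge.
Qed.

Lemma large_cross_pair_common_flat k k' t G G' :
    (t <= k)%N -> (t <= k')%N -> (k + k' + 3 <= n)%N ->
    large_cross_pair k k' t G G' ->
  exists T, [/\ T \in flats t, {in G, forall A, T \subset A} &
                {in G', forall B, T \subset B}].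
Proof.
move=> tk tk' le_n large; have [fG fG' cr ge] := large.
have le_n' : (k' + k + 3 <= n)%N by rewrite [(k' + k)%N]addnC.
have [kn k'n] : (k <= n)%N /\ (k' <= n)%N by lia.
have large' := large_cross_pairC large; have [_ _ cr' _] := large'.
have G_neq0 := large_cross_pair_neq0 kn k'n large.
have G'_neq0 := large_cross_pair_neq0 k'n kn large'.
have [s [T mT]] : exists s T, mincover t G s T.
  have /set0Pn[B BG'] := G'_neq0.
  exact: (mincover_exists (subsetP fG' _ BG') (cross_cover cr BG')).
have [s' [T' mT']] : exists s' T', mincover t G' s' T'.
  have /set0Pn[A AG] := G_neq0.
  by apply: (mincover_exists (subsetP fG _ AG)); apply: cross_cover cr' AG.
have s_eq := large_cross_pair_mincover_dim le_n large mT mT'.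
have s'_eq := large_cross_pair_mincover_dim le_n' large' mT' mT.
subst s s'; have [[fT cT _] [fT' cT' _]] := (mT, mT').
have leG' : #|G'|%:R <= nbetween Q t k' n.
  by rewrite -(star_flat_cover fT' cT') (card_star_le fG') ?tk'.
have geG : nbetween Q t k n <= #|G|%:R.
  rewrite -(ler_pM2r (nbetween_gt0 Q_ge2 t k'n)) (le_trans ge) //.
  by rewrite ler_wpM2l.
exists T; split=> // [A AG | B BG']; first exact: cover_flat_sub fT cT AG.
have cB := cross_cover cr BG'.
exact: (full_star_cover_subset tk le_n fG G_neq0 fT cT geG (subsetP fG' _ BG')).
Qed.

Lemma star_flats_cross k k' t T : T \in flats t ->
  cross t (star (flats k) T) (star (flats k') T).
Proof.
move=> fT; apply/forall_inP => B /[!in_star]/andP[_ TB].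
apply/forall_inP => A /[!in_star]/andP[_ TA].
by rewrite -(card_flat fT) subset_leq_card // subsetI TA.
Qed.

End Flats.

Theorem theorem1p1 (F : finFieldType) (n k1 k2 t : nat)
    (F1 F2 : {set {set 'rV[F]_n}}) :
  0 < n -> 0 < k1 -> 0 < k2 -> 0 < t ->
  t <= k1 -> t <= k2 -> k1 + k2 + 3 <= n ->
  flat_family k1 F1 -> flat_family k2 F2 -> cross_intersecting t F1 F2 ->
  (forall G1 G2 : {set {set 'rV[F]_n}},
      flat_family k1 G1 -> flat_family k2 G2 -> cross_intersecting t G1 G2 ->
      #|G1| * #|G2| <= #|F1| * #|F2|) ->
  exists T : {set 'rV[F]_n},
    is_flat t T /\
    (forall A, A \in F1 -> T \subset A) /\
    (forall B, B \in F2 -> T \subset B).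
Proof.
move=> _ _ _ _ tk1 tk2 le_n /flat_familyP fF1 /flat_familyP fF2.
move=> /(crossP _ fF1 fF2) cr maxF.
have [k1n k2n] : k1 <= n /\ k2 <= n by lia.
have [S fS _] := subflat_exists (setT_in_flats F n) (leq_trans tk1 k1n).
have sub k : star (flats F n k) S \subset flats F n k.
  by apply/subsetP => A; rewrite in_star => /andP[].
have large : large_cross_pair k1 k2 t F1 F2.
  split=> //; rewrite -!(card_star_flats fS) ?tk1 ?tk2 // -!natrM ler_nat.
  apply: maxF; [exact/flat_familyP | exact/flat_familyP |].
  exact/(crossP _ (sub k1) (sub k2))/star_flats_cross.
have [T [fT TF1 TF2]] := large_cross_pair_common_flat tk1 tk2 le_n large.
by exists T; split; first exact/flatsP.
Qed.
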